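(* Let $n\geq2$ and let $F$ be the twirling map on $\mathcal{B}(M_n(\mathbb{C}))$. Then: (1) $F(W_n^+)=W_n^+$ and $F(W_n^-)=W_n^-$. (2) For all $T\in\mathcal{B}(M_n(\mathbb{C}))$, $F(T)=\mathrm{Tr}(\widehat{T}p^+)\,W_n^+ + \mathrm{Tr}(\widehat{T}p^-)\,W_n^-$. (3) If $T$ is completely positive with Choi representation $T(x)=\sum_{i=1}^d a_ixa_i^*$ ($x\in M_n(\mathbb{C})$), where $d\in\mathbb{N}$ and $a_1,\dots,a_d\in M_n(\mathbb{C})$, then $F(T)=c^+(T)W_n^+ + c^-(T)W_n^-$, where $c^+(T)=\frac14\sum_{i=1}^d\|a_i+a_i^t\|_2^2$ and $c^-(T)=\frac14\sum_{i=1}^d\|a_i-a_i^t\|_2^2$.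
   Context: $\mathcal{B}(M_n(\mathbb{C}))$ is the space of linear maps $M_n(\mathbb{C})\to M_n(\mathbb{C})$. For a unitary $u\in\mathcal{U}(n)$ and $T\in\mathcal{B}(M_n(\mathbb{C}))$ let $\rho_u(T)(x)=uT(u^txu^{t*})u^*$, i.e. $\rho_u(T)=\mathrm{ad}(u)\,T\,\mathrm{ad}(u^t)$ with $\mathrm{ad}(v)(x)=vxv^*$; the twirling map is $F(T)=\int_{\mathcal{U}(n)}\rho_u(T)\,du$ (Haar probability measure). The Holevo–Werner channels are $W_n^+(x)=\frac{1}{n+1}(\mathrm{Tr}_n(x)1_n+x^t)$ and $W_n^-(x)=\frac{1}{n-1}(\mathrm{Tr}_n(x)1_n-x^t)$, with $\mathrm{Tr}_n$ the non-normalized trace and $x^t$ the transpose. With $(e_{ij})$ the matrix units of $M_n(\mathbb{C})$, the Jamiolkowski transform is $\widehat{T}=\frac1n\sum_{i,j=1}^nT(e_{ij})\otimes e_{ij}\in M_n(\mathbb{C})\otimes M_n(\mathbb{C})$; $s=\sum_{i,j}e_{ij}\otimes e_{ji}$ is the flip and $p^\pm=\frac12(1\pm s)$; $\mathrm{Tr}$ denotes the non-normalized trace on $M_n(\mathbb{C})\otimes M_n(\mathbb{C})$. $\|x\|_2=\tau_n(x^*x)^{1/2}$ with $\tau_n$ the normalized trace on $M_n(\mathbb{C})$. *)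

(* Defs.v *)
From HB Require Import structures.
From mathcomp Require Import all_boot all_order all_algebra.
From mathcomp Require Import all_classical all_reals all_analysis.
From mathcomp Require Import complex mxtens.
Set Implicit Arguments. Unset Strict Implicit. Unset Printing Implicit Defensive.
Import Order.TTheory GRing.Theory Num.Theory.
Import numFieldNormedType.Exports.
Local Open Scope ring_scope.

(* Complex numbers: R[i] for R : realType.  Matrices: 'M[R[i]]_n. *)

Section Defs.
Variable R : realType.
Local Notation C := R[i].

(* conjugate transpose x^* *)
Definition adjmx (n : nat) (x : 'M[C]_n) : 'M[C]_n :=
  (map_mx (fun z : C => (z^*)%C) x)^T.

Definition unitary (n : nat) (u : 'M[C]_n) : Prop := u *m adjmx u = 1%:M.

(* real and imaginary parts of a complex matrix, as a point of the real
   topological space 'M[R]_n * 'M[R]_n *)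
Definition ReIm_mx (n : nat) (u : 'M[C]_n) : 'M[R]_n * 'M[R]_n :=
  (map_mx (@complex.Re R) u, map_mx (@complex.Im R) u).

(* rho_u(T)(x) = u T(u^t x u^{t*}) u^* *)
Definition rho (n : nat) (u : 'M[C]_n) (T : 'M[C]_n -> 'M[C]_n) :
  'M[C]_n -> 'M[C]_n :=
  fun x => u *m T (u^T *m x *m adjmx (u^T)) *m adjmx u.

(* U : Omega -> 'M[C]_n is a random unitary whose law under P is the Haar
   probability measure on U(n): U takes unitary values, its coordinates are
   measurable, and its law is left-invariant (tested against all continuous
   functions of the real coordinates). *)
Definition haar_unitary (n : nat) (d : measure_display) (Omega : measurableType d)
  (P : probability Omega R) (U : Omega -> 'M[C]_n) : Prop :=
  [/\ (forall w, unitary (U w)),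
      (forall i j, measurable_fun setT (fun w => complex.Re (U w i j)) /\
                   measurable_fun setT (fun w => complex.Im (U w i j))) &
      (forall v : 'M[C]_n, unitary v ->
        forall f : 'M[R]_n * 'M[R]_n -> R, continuous f ->
        Rintegral P setT (fun w => f (ReIm_mx (v *m U w))) =
        Rintegral P setT (fun w => f (ReIm_mx (U w))))].

(* the twirling map F(T) = \int_{U(n)} rho_u(T) du = E[rho_U(T)],
   integral taken entrywise (real and imaginary parts) *)
Definition twirl (n : nat) (d : measure_display) (Omega : measurableType d)
  (P : probability Omega R) (U : Omega -> 'M[C]_n)
  (T : 'M[C]_n -> 'M[C]_n) : 'M[C]_n -> 'M[C]_n :=
  fun x => \matrix_(i, j)
    (Complex (Rintegral P setT (fun w => complex.Re (rho (U w) T x i j)))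
             (Rintegral P setT (fun w => complex.Im (rho (U w) T x i j)))).

(* Holevo-Werner channels *)
Definition Wplus (n : nat) (x : 'M[C]_n) : 'M[C]_n :=
  (n.+1%:R)^-1 *: (\tr x *: 1%:M + x^T).
Definition Wminus (n : nat) (x : 'M[C]_n) : 'M[C]_n :=
  (n.-1%:R)^-1 *: (\tr x *: 1%:M - x^T).

(* Jamiolkowski transform, in M_n (x) M_n = 'M_(n*n) via tensmx *)
Definition jamiolkowski (n : nat) (T : 'M[C]_n -> 'M[C]_n) : 'M[C]_(n * n) :=
  (n%:R)^-1 *: \sum_(i < n) \sum_(j < n) (T (delta_mx i j) *t delta_mx i j).

(* flip s and projections p^+- *)
Definition flip (n : nat) : 'M[C]_(n * n) :=
  \sum_(i < n) \sum_(j < n) (delta_mx i j *t delta_mx j i).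
Definition pplus (n : nat) : 'M[C]_(n * n) := 2^-1 *: (1%:M + flip n).
Definition pminus (n : nat) : 'M[C]_(n * n) := 2^-1 *: (1%:M - flip n).

(* ||x||_2^2 = tau_n(x^* x), tau_n the normalized trace *)
Definition norm2sq (n : nat) (x : 'M[C]_n) : C := (n%:R)^-1 * \tr (adjmx x *m x).

End Defs.

(* Main.v *)
(* Left invariance of the Haar measure gives rho_v (F T) = F T for every unitary
   v, i.e. R := F T \o transpose satisfies R (v y v^* ) = v (R y) v^*.  For a
   projection p, the unitary v = 1 + (i - 1) p has v y v^* - v^* y v = 2 i [p, y],
   so R commutes with [p, .], and by polarization with every [e_ab, .].  On the
   matrix units this forces R y = alpha tr(y) 1 + beta y.  The two coefficients
   are read off from tr (S 1) and sum_ij (S e_ij)_ji at S = F T.  These numbers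
   are invariant under every rho_u, hence agree for S = F T and S = T; they are
   also n times the traces of the Jamiolkowski transform of S, alone and
   multiplied by the flip. *)
Require Import Defs.
From HB Require Import structures.
From mathcomp Require Import all_boot all_order all_algebra.
From mathcomp Require Import all_classical all_reals all_analysis.
From mathcomp Require Import complex mxtens ring.
Import Order.TTheory GRing.Theory Num.Theory.
Import numFieldNormedType.Exports.
Local Open Scope ring_scope.

(** * Real and imaginary parts, and bounds on the entries of a unitary matrix *)

Lemma ReD (R : rcfType) (x y : R[i]) :
  complex.Re (x + y) = complex.Re x + complex.Re y.
Proof. by case: x y => [? ?] []. Qed.

Lemma ImD (R : rcfType) (x y : R[i]) :
  complex.Im (x + y) = complex.Im x + complex.Im y.
Proof. by case: x y => [? ?] []. Qed.

Lemma ReM (R : rcfType) (x y : R[i]) :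
  complex.Re (x * y) = complex.Re x * complex.Re y - complex.Im x * complex.Im y.
Proof. by case: x y => [? ?] []. Qed.

Lemma ImM (R : rcfType) (x y : R[i]) :
  complex.Im (x * y) = complex.Re x * complex.Im y + complex.Im x * complex.Re y.
Proof. by case: x y => [? ?] []. Qed.

(** Inverse of [ReIm_mx]: it lets a function of a complex matrix be read as a function of the real
    coordinates, where the Haar invariance is formulated. *)
Definition of_ReIm_mx (R : realType) (n : nat) (p : 'M[R]_n * 'M[R]_n) :
  'M[R[i]]_n := \matrix_(i, j) Complex (p.1 i j) (p.2 i j).

Lemma ReIm_mxK (R : realType) (n : nat) :
  cancel (@ReIm_mx R n) (@of_ReIm_mx R n).
Proof. by move=> u; apply/matrixP => i j; rewrite !mxE; case: (u i j). Qed.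

(** The squared modulus of [u i j] is one of the nonnegative terms that sum to the [(i, i)] entry of
    [u u^* = 1]. *)
Lemma unitary_entry_le1 (R : realType) (n : nat) (u : 'M[R[i]]_n) (i j : 'I_n) :
  unitary u -> `|u i j| <= 1.
Proof.
move=> /matrixP /(_ i i); rewrite !mxE eqxx => e.
rewrite -(expr_le1 (n := 2)) // -[leRHS]e sqr_normc.
rewrite (bigD1 j) //= !mxE lerDl sumr_ge0 // => k _.
by rewrite !mxE mulcJ_ge0.
Qed.

(** * Expectation of functions of a Haar unitary *)

Section HaarExpectation.
Context {R : realType} {n : nat} {d : measure_display}.
Context {Omega : measurableType d} {P : probability Omega R}.
Context {U : Omega -> 'M[R[i]]_n}.
Hypothesis hU : haar_unitary P U.
Local Notation C := R[i].
Implicit Types (f : 'M[C]_n -> R) (g h : 'M[C]_n -> C).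

(* Continuity is what the left invariance in [haar_unitary] is tested against;
   measurability and boundedness along [U] give integrability. *)
Definition tameR f : Prop :=
  [/\ continuous (f \o @of_ReIm_mx R n), measurable_fun setT (f \o U) &
      exists M, forall w, `|f (U w)| <= M].

Lemma tameR_cst (r : R) : tameR (fun=> r).
Proof.
split; [exact: cst_continuous | exact: measurable_cst |].
by exists `|r|.
Qed.

Lemma tameRD f1 f2 : tameR f1 -> tameR f2 -> tameR (fun u => f1 u + f2 u).
Proof.
move=> [c1 m1 [M1 b1]] [c2 m2 [M2 b2]]; split.
- by move=> x; apply: (@cvgD _ _ _ _ _ (f1 \o _) (f2 \o _)); [exact: c1|exact: c2].
- exact: (measurable_realfun.measurable_funD m1 m2).
- exists (M1 + M2) => w; rewrite (le_trans (ler_normD _ _)) // lerD //.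
Qed.

Lemma tameRM f1 f2 : tameR f1 -> tameR f2 -> tameR (fun u => f1 u * f2 u).
Proof.
move=> [c1 m1 [M1 b1]] [c2 m2 [M2 b2]]; split.
- by move=> x; apply: (@cvgM _ _ _ _ (f1 \o _) (f2 \o _)); [exact: c1|exact: c2].
- exact: (measurable_realfun.measurable_funM m1 m2).
- by exists (M1 * M2) => w; rewrite normrM ler_pM.
Qed.

Lemma tameRN f : tameR f -> tameR (fun u => - f u).
Proof.
move=> tf; under eq_fun => u do rewrite -mulN1r.
by apply: tameRM => //; exact: tameR_cst.
Qed.

Lemma tameR_integrable f : tameR f -> P.-integrable setT (EFin \o (f \o U)).
Proof.
move=> [_ mf [M bf]]; apply: measurable_bounded_integrable => //.
  by rewrite -ge0_fin_numE // fin_num_measure.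
exists M; split; first exact: num_real.
by move=> x Mx w _ /=; exact: (le_trans (bf w) (ltW Mx)).
Qed.

Definition tame g : Prop :=
  tameR (fun u => complex.Re (g u)) /\ tameR (fun u => complex.Im (g u)).

Lemma tame_cst (c : C) : tame (fun=> c).
Proof. by split; exact: tameR_cst. Qed.

Lemma tameD g h : tame g -> tame h -> tame (fun u => g u + h u).
Proof.
move=> [r1 i1] [r2 i2]; split.
- by under eq_fun => u do rewrite ReD; exact: tameRD.
- by under eq_fun => u do rewrite ImD; exact: tameRD.
Qed.

Lemma tameM g h : tame g -> tame h -> tame (fun u => g u * h u).
Proof.
move=> [r1 i1] [r2 i2]; split.
- under eq_fun => u do rewrite ReM.
  by apply: tameRD; [exact: tameRM | apply: tameRN; exact: tameRM].
- under eq_fun => u do rewrite ImM.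
  by apply: tameRD; exact: tameRM.
Qed.

Lemma tame_conj g : tame g -> tame (fun u => (g u)^*%C).
Proof.
move=> [r1 i1]; split.
- by rewrite (_ : (fun u => _) = fun u => complex.Re (g u)) //;
    apply/funext => u; case: (g u).
- rewrite (_ : (fun u => _) = fun u => - complex.Im (g u)); first exact: tameRN.
  by apply/funext => u; case: (g u).
Qed.

Lemma tame_sum (I : Type) (s : seq I) (g : I -> 'M[C]_n -> C) :
  (forall i, tame (g i)) -> tame (fun u => \sum_(i <- s) g i u).
Proof.
move=> tg; elim: s => [|i s IHs].
  by under eq_fun => u do rewrite big_nil; exact: tame_cst.
by under eq_fun => u do rewrite big_cons; exact: tameD.
Qed.

(** Base case of the closure lemmas: coordinates are continuous, and unitarity bounds them by 1. All
    polynomials in the entries and their conjugates are then tame. *)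
Lemma tame_coord (i j : 'I_n) : tame (fun u => u i j).
Proof.
have [Uu mU _] := hU.
have bU w : `|complex.Re (U w i j)| <= 1 /\ `|complex.Im (U w i j)| <= 1.
  have := unitary_entry_le1 _ _ _ i j (Uu w); rewrite normc_def lecR => b1.
  by split; apply: le_trans b1; rewrite -sqrtr_sqr ler_wsqrtr // ?lerDl ?lerDr sqr_ge0.
split; split.
- rewrite (_ : _ \o _ = fun p : 'M[R]_n * 'M[R]_n => p.1 i j); last first.
    by apply/funext => p /=; rewrite mxE.
  by move=> p; apply: (@continuous_comp _ _ _ fst (fun M : 'M[R]_n => M i j));
    [exact: cvg_fst | exact: coord_continuous].
- by have [] := mU i j.
- by exists 1 => w; have [] := bU w.
- rewrite (_ : _ \o _ = fun p : 'M[R]_n * 'M[R]_n => p.2 i j); last first.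
    by apply/funext => p /=; rewrite mxE.
  by move=> p; apply: (@continuous_comp _ _ _ snd (fun M : 'M[R]_n => M i j));
    [exact: cvg_snd | exact: coord_continuous].
- by have [] := mU i j.
- by exists 1 => w; have [] := bU w.
Qed.

(** Written exactly as the entries of [twirl], so that [twirl] is an entrywise [expect] by
    computation. *)
Definition expect g : C :=
  Complex (Rintegral P setT (fun w => complex.Re (g (U w))))
          (Rintegral P setT (fun w => complex.Im (g (U w)))).

Lemma expect_cst (c : C) : expect (fun=> c) = c.
Proof.
rewrite /expect !Rintegral_cst //.
have e : fine (P setT) = 1 :> R by move: (probability_setT P) => /= ->.
rewrite [X in _ * X]e [X in Complex _ (_ * X)]e !mulr1.
by case: c.
Qed.

Lemma expectD g h : tame g -> tame h ->
  expect (fun u => g u + h u) = expect g + expect h.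
Proof.
move=> [/tameR_integrable r1 /tameR_integrable i1].
move=> [/tameR_integrable r2 /tameR_integrable i2]; congr Complex.
- rewrite -[RHS](RintegralD measurableT r1 r2).
  by apply: eq_Rintegral => w _; rewrite ReD.
- rewrite -[RHS](RintegralD measurableT i1 i2).
  by apply: eq_Rintegral => w _; rewrite ImD.
Qed.

Lemma expectZ (c : C) g : tame g -> expect (fun u => c * g u) = c * expect g.
Proof.
move=> [/tameR_integrable r1 /tameR_integrable i1].
have [re_c im_c] : (forall w, complex.Re (c * g (U w)) =
    complex.Re c * complex.Re (g (U w)) - complex.Im c * complex.Im (g (U w))) /\
  (forall w, complex.Im (c * g (U w)) =
    complex.Re c * complex.Im (g (U w)) + complex.Im c * complex.Re (g (U w))).
  by split=> w; rewrite ?ReM ?ImM.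
have integrableZ r (f : Omega -> R) : P.-integrable setT (EFin \o f) ->
    P.-integrable setT (EFin \o (fun w => r * f w)).
  move=> fi; rewrite (_ : _ \o _ = fun w => (r%:E * (f w)%:E)%E) //.
  exact: integrableZl.
apply/eqP; rewrite eq_complex ReM ImM /=; apply/andP; split; apply/eqP.
- rewrite -[X in X - _](RintegralZl _ measurableT r1).
  rewrite -[X in _ - X](RintegralZl _ measurableT i1).
  rewrite -[RHS](RintegralB measurableT (integrableZ _ _ r1) (integrableZ _ _ i1)).
  by apply: eq_Rintegral => w _; rewrite re_c.
- rewrite -[X in X + _](RintegralZl _ measurableT i1).
  rewrite -[X in _ + X](RintegralZl _ measurableT r1).
  rewrite -[RHS](RintegralD measurableT (integrableZ _ _ i1) (integrableZ _ _ r1)).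
  by apply: eq_Rintegral => w _; rewrite im_c.
Qed.

Lemma expect_sum (I : Type) (s : seq I) (g : I -> 'M[C]_n -> C) :
  (forall i, tame (g i)) ->
  expect (fun u => \sum_(i <- s) g i u) = \sum_(i <- s) expect (g i).
Proof.
move=> tg; elim: s => [|i s IHs].
  by under eq_fun => u do rewrite big_nil; rewrite big_nil expect_cst.
under eq_fun => u do rewrite big_cons.
by rewrite expectD ?IHs ?big_cons //; exact: tame_sum.
Qed.

(** The invariance of the law applies to the real and imaginary parts of [g], each precomposed with
    [of_ReIm_mx]; tameness makes these continuous. *)
Lemma expect_invl (v : 'M[C]_n) g : unitary v -> tame g ->
  expect (fun u => g (v *m u)) = expect g.
Proof.
have [_ _ inv] := hU; move=> uv [[cr _ _] [ci _ _]].
have {}inv f : continuous (f \o @of_ReIm_mx R n) ->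
    Rintegral P setT (fun w => f (v *m U w)) = Rintegral P setT (fun w => f (U w)).
  move=> /(inv _ uv) /= e.
  transitivity (Rintegral P setT (fun w => f (of_ReIm_mx _ _ (ReIm_mx (v *m U w))))).
    by apply: eq_Rintegral => w _; rewrite ReIm_mxK.
  by rewrite e; apply: eq_Rintegral => w _; rewrite ReIm_mxK.
by rewrite /expect (inv _ cr) (inv _ ci).
Qed.

End HaarExpectation.

(** * Tensors commuting with the matrix units *)

Lemma mulmx_deltaE (R : comPzRingType) (m n p q : nat) (A : 'M[R]_(m, n))
    (B : 'M[R]_(p, q)) (k : 'I_n) (l : 'I_p) (i : 'I_m) (j : 'I_q) :
  (A *m delta_mx k l *m B) i j = A i k * B l j.
Proof.
rewrite !mxE (bigD1 l) //= big1 ?addr0 => [|r rl]; rewrite mxE (bigD1 k) //=.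
  by rewrite !mxE !eqxx mulr1 big1 ?addr0 // => s sk; rewrite mxE (negPf sk) mulr0.
by rewrite !mxE (negPf rl) andbF mulr0 add0r big1 ?mul0r // => s sk;
  rewrite mxE (negPf rl) andbF mulr0.
Qed.

(* [r k l i j] is the [(i, j)] entry of the image of the matrix unit [e_kl] under
   a linear map; [r_comm] says that this map commutes with every [[e_ab, .]]. *)
Section Tensor.
Context {R : comPzRingType} {n : nat}.
Variable r : 'I_n -> 'I_n -> 'I_n -> 'I_n -> R.
Hypothesis r_comm : forall a b k l i j,
  r a l i j *+ (b == k) - r k b i j *+ (l == a) =
  (i == a)%:R * r k l b j - r k l i a * (b == j)%:R.

(** [[e_ii, e_bb] = 0], while for [i != j] the [(i, j)] entry of [[e_ii, M]] is [M i j]. *)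
Let r_diag b i j : i != j -> r b b i j = 0.
Proof.
move=> ij; have := r_comm i i b b i j.
rewrite eqxx (negPf ij) mulr0 subr0 mul1r => <-.
by case: eqVneq => [->|]; rewrite ?subrr // subr0.
Qed.

(** [e_ij] and [e_bb] annihilate each other on both sides, and the [(i, j)] entry of [[e_ij, M]] is
    [M j j - M i i]. *)
Let r_off_row b i j : i != b -> j != b -> r b b i i = r b b j j.
Proof.
move=> ib jb; have := r_comm i j b b i j.
rewrite !eqxx (negPf jb) [b == i]eq_sym (negPf ib) !mulr0n subr0 mul1r mulr1.
by move/eqP; rewrite eq_sym subr_eq0 => /eqP.
Qed.

(** From [[e_ab, e_bb] = e_ab]: the image of [e_ab] is determined by that of [e_bb], which is
    diagonal. *)
Let r_offl a b i j : a != b ->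
  r a b i j = ((i == a) && (j == b))%:R * (r b b b b - r b b a a).
Proof.
move=> ab; have := r_comm a b b b i j.
rewrite eqxx [b == a]eq_sym (negPf ab) mulr0n mulr1n subr0 => ->.
case: (eqVneq i a) => [->|ia]; case: (eqVneq j b) => [->|jb] /=;
  rewrite ?eqxx ?[b == j]eq_sym ?(negPf jb) ?mul1r ?mulr1 ?mul0r ?mulr0 ?subr0 //.
- by rewrite r_diag // eq_sym.
- by rewrite (r_diag _ _ _ ia) subr0.
Qed.

(** The same from [[e_ab, e_aa] = - e_ab]. Having both formulas allows the images of [e_aa] and
    [e_bb] to be compared. *)
Let r_offr a b i j : a != b ->
  r a b i j = ((i == a) && (j == b))%:R * (r a a a a - r a a b b).
Proof.
move=> ab; have := r_comm a b a a i j.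
rewrite eqxx [b == a]eq_sym (negPf ab) mulr0n mulr1n sub0r => /eqP.
rewrite eqr_oppLR opprB => /eqP ->.
case: (eqVneq i a) => [->|ia]; case: (eqVneq j b) => [->|jb] /=;
  rewrite ?eqxx ?[b == j]eq_sym ?(negPf jb) ?mul1r ?mulr1 ?mul0r ?mulr0 ?subr0 //.
- by rewrite r_diag ?subr0 // eq_sym.
- by rewrite (r_diag _ _ _ ia).
Qed.

(** The [(a, a)] entry of the relation for [[e_ab, e_ba] = e_aa - e_bb]. *)
Let r_off_sym a b : a != b -> r a a b b = r b b a a.
Proof.
move=> ab; have ba : b != a by rewrite eq_sym.
have := r_comm a b b a a a; rewrite !eqxx (negPf ba) !mulr1n mulr0 subr0 mul1r.
by rewrite (r_offl b a b a ba) !eqxx mul1r => /addrI /oppr_inj.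
Qed.

(** The right side is the tensor of [y |-> al tr(y) 1 + be y]. Everything reduces to the values
    [r a a b b]: those with [a != b] all coincide, and so do the [r a a a a]. *)
Lemma gl_equivariant_tensor (o o' : 'I_n) : o != o' ->
  exists al be : R, forall k l i j,
    r k l i j = al * ((k == l) && (i == j))%:R + be * ((i == k) && (j == l))%:R.
Proof.
move=> oo'; pose al := r o o o' o'; pose be := r o o o o - al.
have o'o : o' != o by rewrite eq_sym.
(* Any pair is moved to [(o, o')]: change the second index, swap the two, change the second index
   again. *)
have off a b : a != b -> r a a b b = al.
  move=> ab; have ba : b != a by rewrite eq_sym.
  have [ao|ao] := eqVneq a o; first by rewrite ao in ba *; exact: r_off_row.
  rewrite (r_off_row _ _ o) // 1?eq_sym // r_off_sym //; exact: r_off_row.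
have diag a : r a a a a = al + be.
  rewrite /be addrC subrK; have [->//|ao] := eqVneq a o.
  have oa : o != a by rewrite eq_sym.
  (* The two formulas for [r a o a o] give [r o o o o - al = r a a a a - al]. *)
  have := r_offl a o a o ao; rewrite (r_offr a o a o ao) !eqxx !mul1r.
  by rewrite (off a o ao) (off o a oa) => /addIr.
exists al, be => k l i j.
have [<-|kl] := eqVneq k l; last first.
  have lk : l != k by rewrite eq_sym.
  by rewrite r_offl // (off l k lk) diag [al + be]addrC addrK mulr0 add0r mulrC.
have [<-|ij] := eqVneq i j; rewrite /= ?mulr1 ?mulr0 ?add0r.
  rewrite andbb; have [->|ik] := eqVneq i k; first by rewrite diag mulr1.
  by rewrite off 1?eq_sym // mulr0 addr0.
rewrite r_diag //; case: (eqVneq i k) ij => [->|] /=; rewrite ?mulr0 //.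
by rewrite eq_sym => /negPf ->; rewrite mulr0.
Qed.

End Tensor.

(** * Adjoints and the composition law of [rho] *)

Section Adjoint.
Context {R : realType} {n : nat}.
Local Notation C := R[i].
Implicit Types x y u v : 'M[C]_n.

Lemma adjmxE x i j : adjmx x i j = ((x j i)^*)%C.
Proof. by rewrite !mxE. Qed.

Lemma adjmxM x y : adjmx (x *m y) = adjmx y *m adjmx x.
Proof. by rewrite /adjmx (map_mxM conjc) trmx_mul. Qed.

Lemma adjmx_tr x : adjmx x^T = (adjmx x)^T.
Proof. by apply/matrixP => i j; rewrite !mxE. Qed.

Lemma adjmx1Z x (c : C) :
  adjmx (1%:M + c *: x) = 1%:M + (c^*)%C *: adjmx x.
Proof.
by apply/matrixP => i j; rewrite adjmxE !mxE rmorphD rmorphM rmorph_nat eq_sym.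
Qed.

Lemma unitaryC u : unitary u -> adjmx u *m u = 1%:M.
Proof. exact: mulmx1C. Qed.

Lemma rhoM u v (T : 'M[C]_n -> 'M[C]_n) x :
  rho (v *m u) T x = v *m rho u T (v^T *m x *m adjmx v^T) *m adjmx v.
Proof. by rewrite /rho !trmx_mul !adjmxM !mulmxA. Qed.

End Adjoint.

(** * Linear maps covariant under unitary conjugation *)

Lemma conjc_i (R : rcfType) : ('i%C : R[i])^*%C = - 'i%C.
Proof. by apply/eqP; rewrite eq_complex /= oppr0 !eqxx. Qed.

Section UnitaryCovariant.
Context {R : realType} {n : nat}.
Local Notation C := R[i].
Variable S : {linear 'M[C]_n -> 'M[C]_n}.
Hypothesis S_cov : forall v, unitary v -> forall y,
  S (v *m y *m adjmx v) = v *m S y *m adjmx v.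

Let commutes (h : 'M[C]_n) : Prop := forall y,
  S (h *m y - y *m h) = h *m S y - S y *m h.

Let commutesD h k : commutes h -> commutes k -> commutes (h + k).
Proof.
move=> Hh Hk y; rewrite !mulmxDl !mulmxDr !opprD.
by rewrite [in LHS]addrACA linearD Hh Hk addrACA.
Qed.

Let commutesZ c h : commutes h -> commutes (c *: h).
Proof.
move=> Hh y.
by rewrite -!scalemxAl -!scalemxAr -!scalerBr linearZ /= Hh.
Qed.

(* For v = 1 + (i - 1) p one has v y v^* - v^* y v = 2 i (p y - y p). *)
Let commutes_proj p : adjmx p = p -> p *m p = p -> commutes p.
Proof.
move=> pa pp.
pose c : C := 'i%C - 1; pose c' : C := - 'i%C - 1.
have i2 : ('i%C : C) * 'i%C = -1 by rewrite -expr2 sqr_i.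
have cJ : (c^*)%C = c' by rewrite /c rmorphB rmorph1; congr (_ - 1); exact: conjc_i.
have c'J : (c'^*)%C = c by rewrite -cJ conjcK.
have conjE (a b : C) y : (1%:M + a *: p) *m y *m (1%:M + b *: p) =
    y + b *: (y *m p) + a *: (p *m y) + (a * b) *: (p *m y *m p).
  rewrite mulmxDl mul1mx mulmxDr mulmx1 !mulmxDl -!scalemxAl -!scalemxAr.
  by rewrite scalerA addrACA addrA.
(* For a projection [p] the product is [1 + (a + b + a b) p], so the condition reads
   [(1 + a)(1 + b) = 1]. It holds for [c] and [c'] since [1 + c = i] and [1 + c' = - i]. *)
have unit_v a b : a + b + a * b = 0 -> (a^*)%C = b -> unitary (1%:M + a *: p).
  move=> ab aJ; rewrite /unitary adjmx1Z pa aJ -[X in X *m _]mulmx1 conjE.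
  rewrite mul1mx !mulmx1 pp -!addrA -!scalerDl.
  by rewrite (_ : b + (a + a * b) = 0) ?scale0r ?addr0 // -ab; ring.
have uv : unitary (1%:M + c *: p).
  by apply: (unit_v c c') => //; rewrite /c /c'; ring: i2.
have uv' : unitary (1%:M + c' *: p).
  by apply: (unit_v c' c) => //; rewrite /c /c'; ring: i2.
have difE y :
    (1%:M + c *: p) *m y *m (1%:M + c' *: p) -
    (1%:M + c' *: p) *m y *m (1%:M + c *: p) = (2 * 'i%C) *: (p *m y - y *m p).
  rewrite !conjE; move: (p *m y *m p) (p *m y) (y *m p) => z1 z2 z3.
  by apply/matrixP => k l; rewrite !mxE /c /c'; ring.
move=> y; have i0 : (2 * 'i%C : C) != 0.
  rewrite mulf_neq0 ?pnatr_eq0 //; apply/eqP => i0.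
  by move: i2; rewrite i0 mul0r => /eqP; rewrite eq_sym oppr_eq0 oner_eq0.
apply: (scalerI i0); rewrite -linearZ -!difE linearB /=.
have := S_cov _ uv y; have := S_cov _ uv' y.
by rewrite !adjmx1Z pa cJ c'J => -> ->.
Qed.

(** Conjugate transpose of a column; [adjmx] covers square matrices only. *)
Let adjcv (w : 'cV[C]_n) : 'rV[C]_n := (map_mx conjc w)^T.

(** For [w != 0], dividing [w w^*] by the squared length [c] of [w] gives a self-adjoint projection,
    to which [commutes_proj] applies. *)
Let commutes_rank1 w : commutes (w *m adjcv w).
Proof.
pose c := (adjcv w *m w) 0 0.
have cE : adjcv w *m w = c%:M by rewrite [LHS]mx11_scalar.
have c_sum : c = \sum_i `|w i 0| ^+ 2.
  by rewrite /c mxE; apply: eq_bigr => i _; rewrite !mxE sqr_normc mulrC.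
have [c0|c0] := eqVneq c 0.
  suff -> : w = 0 by rewrite mul0mx => y; rewrite !mul0mx !mulmx0 subr0 linear0.
  move: c0; rewrite c_sum => /eqP.
  rewrite psumr_eq0 => [/allP w0|i _]; last by rewrite exprn_ge0.
  apply/matrixP => i j; rewrite (ord1 j) mxE.
  by have := w0 i (mem_index_enum _); rewrite expf_eq0 /= normr_eq0 => /eqP.
have cJ : (c^*)%C = c.
  rewrite c_sum rmorph_sum; apply: eq_bigr => i _.
  by rewrite sqr_normc rmorphM [X in _ * X]conjcK mulrC.
suff : commutes (c^-1 *: (w *m adjcv w)).
  by move=> /(commutesZ c); rewrite scalerA divff // scale1r.
apply: commutes_proj.
  have cVJ : (c^-1)^*%C = c^-1 by rewrite conjc_inv cJ.
  apply/matrixP => i j; rewrite adjmxE [in LHS]mxE rmorphM [X in X * _]cVJ.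
  rewrite [in RHS]mxE; congr (_ * _); rewrite !mxE !big_ord1 !mxE.
  by rewrite rmorphM [X in _ * X]conjcK mulrC.
rewrite -scalemxAl -scalemxAr scalerA mulmxA -[_ *m _ *m w]mulmxA cE.
by rewrite mul_mx_scalar -scalemxAl scalerA -mulrA mulVf // mulr1.
Qed.

Lemma commutes_delta a b y :
  S (delta_mx a b *m y - y *m delta_mx a b) =
  delta_mx a b *m S y - S y *m delta_mx a b.
Proof.
pose e (a : 'I_n) : 'cV[C]_n := delta_mx a 0.
have eE i j : e i *m adjcv (e j) = delta_mx i j.
  rewrite (_ : adjcv (e j) = delta_mx 0 j) ?mul_delta_mx //.
  by apply/matrixP => k l; rewrite !mxE rmorph_nat andbC.
pose w (z : C) := e a + z *: e b.
have wE z z' : (z^*)%C = z' -> w z *m adjcv (w z) = delta_mx a a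
    + z' *: delta_mx a b + z *: delta_mx b a + (z * z') *: delta_mx b b.
  move=> <-; rewrite -!eE (_ : adjcv (w z) = adjcv (e a) + (z^*)%C *: adjcv (e b)).
    by rewrite mulmxDl !mulmxDr -!scalemxAl -!scalemxAr scalerA addrA.
  by apply/matrixP => k l; rewrite !mxE rmorphD rmorphM.
have i2 : ('i%C : C) * 'i%C = -1 by rewrite -expr2 sqr_i.
suff : commutes (delta_mx a b) by apply.
(* Polarization: 4 e_a e_b^* is the sum of z w_z w_z^* over z^4 = 1. *)
rewrite (_ : delta_mx a b = 4^-1 *: (w 1 *m adjcv (w 1) + (-1) *: (w (-1) *m adjcv (w (-1)))
   + 'i%C *: (w 'i%C *m adjcv (w 'i%C)) + (- 'i%C) *: (w (- 'i%C) *m adjcv (w (- 'i%C))))).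
  apply: commutesZ; do ?apply: commutesD; do ?apply: commutesZ; exact: commutes_rank1.
have i4 : (4 : C) != 0 by rewrite pnatr_eq0.
apply: (scalerI i4); rewrite scalerA divff // scale1r.
have iJ : (- 'i%C : C)^*%C = 'i%C by rewrite -conjc_i conjcK.
have oneJ : (-1 : C)^*%C = -1 by rewrite rmorphN1.
rewrite (wE _ _ (conjc1 R)) (wE _ _ oneJ) (wE _ _ (conjc_i R)) (wE _ _ iJ).
move: (delta_mx a b) (delta_mx a a) (delta_mx b a) (delta_mx b b) => m1 m2 m3 m4.
by apply/matrixP => k l; rewrite !mxE; ring: i2.
Qed.

(** The entries of [commutes_delta] on matrix units are the relations [r_comm] for the tensor of
    [S]; [2 <= n] supplies the two distinct indices. *)
Lemma unitary_covariantP : (2 <= n)%N ->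
  exists al be : C, forall y, S y = (al * \tr y)%:M + be *: y.
Proof.
move=> n2; pose o := Ordinal (ltnW n2); pose o' := Ordinal n2.
have [|al [be r]] := @gl_equivariant_tensor C n
    (fun k l i j => S (delta_mx k l) i j) _ o o' isT.
  move=> a b k l i j; have := congr1 (fun M : 'M[C]_n => M i j)
    (commutes_delta a b (delta_mx k l)).
  rewrite !mul_delta_mx_cond linearB !raddfMn /= => e.
  have dl (M : 'M[C]_n) : (delta_mx a b *m M) i j = (i == a)%:R * M b j.
    by rewrite -[delta_mx a b]mul1mx mulmx_deltaE mxE.
  have dr (M : 'M[C]_n) : (M *m delta_mx a b) i j = M i a * (b == j)%:R.
    by rewrite -[M *m _]mulmx1 mulmx_deltaE mxE.
  have subE (M N : 'M[C]_n) : (M - N) i j = M i j - N i j by rewrite !mxE.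
  move: e; rewrite !subE dl dr => <-.
  by rewrite [RHS]mxE !mulmxnE [X in _ = _ + X *+ _]mxE mulNrn.
exists al, be => y; rewrite {1}[y]matrix_sum_delta.
apply/matrixP => i j; rewrite linear_sum summxE.
transitivity (\sum_k \sum_l y k l * (al * ((k == l) && (i == j))%:R
    + be * ((i == k) && (j == l))%:R)).
  apply: eq_bigr => k _; rewrite linear_sum summxE; apply: eq_bigr => l _.
  by rewrite linearZ mxE r.
under eq_bigr => k _ do under eq_bigr => l _ do rewrite mulrDr.
under eq_bigr => k _ do rewrite big_split /=.
rewrite big_split /= !mxE; congr (_ + _).
  rewrite /mxtrace mulr_sumr -sumrMnl; apply: eq_bigr => k _.
  rewrite (bigD1 k) //= eqxx big1 ?addr0 => [|l lk].
    by rewrite mulrA [y k k * al]mulrC mulr_natr.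
  by rewrite eq_sym (negPf lk) !mulr0.
rewrite (bigD1 i) //= (bigD1 j) //= !eqxx big1 ?addr0 => [|l lj]; last first.
  by rewrite eq_sym (negPf lj) !mulr0.
rewrite big1 ?addr0 => [|k ki]; first by rewrite mulr1 mulrC.
by apply: big1 => l _; rewrite eq_sym (negPf ki) !mulr0.
Qed.

End UnitaryCovariant.

(** * Trace invariants of a map, its Jamiolkowski transform and its Kraus form *)

Lemma mxtrace_sum (V : nmodType) (n : nat) (I : Type) (s : seq I) (F : I -> 'M[V]_n) :
  \tr (\sum_(i <- s) F i) = \sum_(i <- s) \tr (F i).
Proof. exact: raddf_sum. Qed.

Lemma mxtrace_tens (R : pzRingType) (m n : nat) (A : 'M[R]_m) (B : 'M[R]_n) :
  \tr (A *t B) = \tr A * \tr B.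
Proof. by rewrite /mxtrace mulr_sum; apply: eq_bigr => i _; rewrite mxE. Qed.

Lemma mxtrace_mul_delta (R : comPzRingType) (n : nat) (A : 'M[R]_n) (k l : 'I_n) :
  \tr (A *m delta_mx k l) = A l k.
Proof.
rewrite /mxtrace (bigD1 l) //= big1 ?addr0 => [|i il].
  by rewrite -[A *m _]mulmx1 mulmx_deltaE mxE eqxx mulr1.
by rewrite -[A *m _]mulmx1 mulmx_deltaE mxE eq_sym (negPf il) mulr0.
Qed.

Section Invariants.
Context {R : realType} {n : nat}.
Local Notation C := R[i].
Implicit Types T : 'M[C]_n -> 'M[C]_n.

Definition tr1 T : C := \tr (T 1%:M).
Definition trflip T : C := \sum_i \sum_j T (delta_mx i j) j i.

(** The swap trick: the summand [e_ij (x) e_ji] of the flip contributes [A j i * B i j]. *)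
Lemma mxtrace_tens_flip (A B : 'M[C]_n) : \tr (A *t B *m flip R n) = \tr (A *m B).
Proof.
rewrite /flip mulmx_sumr mxtrace_sum.
transitivity (\sum_i \sum_j A j i * B i j).
  apply: eq_bigr => i _; rewrite mulmx_sumr mxtrace_sum; apply: eq_bigr => j _.
  by rewrite tensmx_mul mxtrace_tens !mxtrace_mul_delta.
by rewrite exchange_big; apply: eq_bigr => j _; rewrite mxE.
Qed.

(** Since [tr e_ij] vanishes off the diagonal, only the [T e_ii] remain, and they add up to [T 1] by
    linearity. *)
Lemma mxtrace_jamiolkowski (T : {linear 'M[C]_n -> 'M[C]_n}) :
  \tr (jamiolkowski T) = n%:R^-1 * tr1 T.
Proof.
rewrite /jamiolkowski linearZ /=; congr (_ * _); rewrite mxtrace_sum.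
rewrite /tr1 scalar_mx_sum_delta !linear_sum; apply: eq_bigr => i _ /=.
rewrite mxtrace_sum (bigD1 i) //= big1 ?addr0 => [|j ji].
  by rewrite mxtrace_tens scale1r -[delta_mx i i in X in _ * X]mul1mx
     mxtrace_mul_delta mxE eqxx mulr1.
by rewrite mxtrace_tens -[X in _ * \tr X]mul1mx mxtrace_mul_delta mxE (negPf ji) mulr0.
Qed.

Lemma mxtrace_jamiolkowski_flip T :
  \tr (jamiolkowski T *m flip R n) = n%:R^-1 * trflip T.
Proof.
rewrite /jamiolkowski -scalemxAl linearZ /=; congr (_ * _).
rewrite mulmx_suml mxtrace_sum; apply: eq_bigr => i _.
rewrite mulmx_suml mxtrace_sum; apply: eq_bigr => j _.
by rewrite mxtrace_tens_flip mxtrace_mul_delta.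
Qed.

Lemma linear_mxE (T : {linear 'M[C]_n -> 'M[C]_n}) x i j :
  T x i j = \sum_k \sum_l x k l * T (delta_mx k l) i j.
Proof.
rewrite {1}[x]matrix_sum_delta linear_sum summxE; apply: eq_bigr => k _.
by rewrite linear_sum summxE; apply: eq_bigr => l _; rewrite linearZ mxE.
Qed.

Lemma tr1_rho (u : 'M[C]_n) T : unitary u -> tr1 (rho u T) = tr1 T.
Proof.
move=> uu; rewrite /tr1 /rho mulmx1 adjmx_tr -trmx_mul unitaryC // trmx1.
by rewrite mxtrace_mulC mulmxA unitaryC // mul1mx.
Qed.

(** In coordinates the left side is a sixfold sum; the sums over [i] and [j] contract by
    orthonormality of the columns of [u], leaving the sum for [T]. *)
Lemma trflip_rho (u : 'M[C]_n) (T : {linear 'M[C]_n -> 'M[C]_n}) :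
  unitary u -> trflip (rho u T) = trflip T.
Proof.
move=> uu; pose t k l p q := T (delta_mx k l) p q.
have orth k q : \sum_i u i k * (u i q)^*%C = (k == q)%:R.
  have := congr1 (fun M : 'M[C]_n => M q k) (unitaryC _ uu).
  rewrite !mxE eq_sym => <-; apply: eq_bigr => i _.
  by rewrite adjmxE mulrC.
transitivity (\sum_k \sum_l \sum_p \sum_q
    (k == q)%:R * (p == l)%:R * t k l p q).
  transitivity (\sum_i \sum_j \sum_k \sum_l \sum_p \sum_q
     (u i k * (u i q)^*%C) * (u j p * (u j l)^*%C) * t k l p q).
    apply: eq_bigr => i _; apply: eq_bigr => j _.
    rewrite /rho [LHS]mxE.
    transitivity (\sum_q \sum_p \sum_k \sum_l
       (u i k * (u i q)^*%C) * (u j p * (u j l)^*%C) * t k l p q).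
      apply: eq_bigr => q _; rewrite mxE mulr_suml; apply: eq_bigr => p _.
      rewrite linear_mxE mulr_sumr mulr_suml; apply: eq_bigr => k _.
      rewrite mulr_sumr mulr_suml; apply: eq_bigr => l _.
      by rewrite mulmx_deltaE !adjmxE !mxE -/(t k l p q); ring.
    rewrite exchange_big; under eq_bigr => p _ do rewrite exchange_big /=.
    rewrite exchange_big; apply: eq_bigr => k _.
    under eq_bigr => p _ do rewrite exchange_big /=.
    by rewrite exchange_big.
  under eq_bigr => i _ do rewrite exchange_big /=.
  rewrite exchange_big; apply: eq_bigr => k _.
  under eq_bigr => i _ do rewrite exchange_big /=.
  rewrite exchange_big; apply: eq_bigr => l _.
  under eq_bigr => i _ do rewrite exchange_big /=.
  rewrite exchange_big; apply: eq_bigr => p _.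
  under eq_bigr => i _ do rewrite exchange_big /=.
  rewrite exchange_big; apply: eq_bigr => q _.
  rewrite -!orth !mulr_suml; apply: eq_bigr => i _.
  by rewrite mulr_sumr mulr_suml.
apply: eq_bigr => k _; apply: eq_bigr => l _.
rewrite (bigD1 l) //= (bigD1 k) //= !eqxx !mul1r.
rewrite big1 ?addr0 => [|q qk]; last by rewrite eq_sym (negPf qk) !mul0r.
rewrite big1 ?addr0 // => p pl.
by apply: big1 => q _; rewrite (negPf pl) mulr0 mul0r.
Qed.

Lemma tr1_kraus (k : nat) (a : 'I_k -> 'M[C]_n) :
  tr1 (fun x => \sum_(m < k) a m *m x *m adjmx (a m)) =
  \sum_(m < k) \tr (adjmx (a m) *m a m).
Proof.
rewrite /tr1 mxtrace_sum; apply: eq_bigr => m _ /=.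
by rewrite mulmx1 mxtrace_mulC.
Qed.

Lemma trflip_kraus (k : nat) (a : 'I_k -> 'M[C]_n) :
  trflip (fun x => \sum_(m < k) a m *m x *m adjmx (a m)) =
  \sum_(m < k) \tr (adjmx (a m) *m (a m)^T).
Proof.
rewrite /trflip; under eq_bigr => i _ do under eq_bigr => j _ do rewrite summxE.
under eq_bigr => i _ do rewrite exchange_big /=.
rewrite exchange_big; apply: eq_bigr => m _; rewrite exchange_big.
apply: eq_bigr => i _; rewrite mxE; apply: eq_bigr => j _.
by rewrite mulmx_deltaE mulrC !mxE.
Qed.

Lemma mxtrace_adj_tr (a : 'M[C]_n) : \tr (adjmx a^T *m a^T) = \tr (adjmx a *m a).
Proof. by rewrite adjmx_tr -trmx_mul mxtrace_tr mxtrace_mulC. Qed.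

Lemma mxtrace_adj_trC (a : 'M[C]_n) : \tr (adjmx a^T *m a) = \tr (adjmx a *m a^T).
Proof. by rewrite adjmx_tr -mxtrace_tr trmx_mul trmxK mxtrace_mulC. Qed.

(** The two square terms have equal traces, and so have the two cross terms; hence the factor 2. The
    values [e = 1] and [e = -1] give the summands of [c^+] and [c^-]. *)
Lemma norm2sqDZ (a : 'M[C]_n) (e : C) : (e^*)%C = e -> e * e = 1 ->
  4^-1 * norm2sq (a + e *: a^T) =
  (2 * n%:R)^-1 * (\tr (adjmx a *m a) + e * \tr (adjmx a *m a^T)).
Proof.
move=> eJ ee; rewrite /norm2sq.
have -> : adjmx (a + e *: a^T) = adjmx a + e *: adjmx a^T.
  by apply/matrixP => i j; rewrite adjmxE !mxE rmorphD rmorphM [X in _ + X * _]eJ.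
rewrite mulmxDl !mulmxDr -!scalemxAl -!scalemxAr scalerA ee scale1r.
rewrite !linearD /= !linearZ /= mxtrace_adj_tr mxtrace_adj_trC.
have -> : (4 : C) = 2 * 2 by ring.
rewrite !invfM; have : (2 : C) * 2^-1 = 1 by rewrite divff // pnatr_eq0.
by move=> h; ring: h.
Qed.

End Invariants.

(** * The twirling map and its formula in terms of the two invariants *)

Section Twirl.
Context {R : realType} {n : nat} {d : measure_display}.
Context {Omega : measurableType d} {P : probability Omega R}.
Context {U : Omega -> 'M[R[i]]_n}.
Hypothesis hU : haar_unitary P U.
Local Notation C := R[i].
Implicit Types (T : {linear 'M[C]_n -> 'M[C]_n}) (G H : 'M[C]_n -> 'M[C]_n).
Local Notation tame := (@tame R n d Omega U).
Local Notation expect := (@expect R n d Omega P U).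

Definition tame_mx G : Prop := forall i j, tame (fun u => G u i j).

Definition expect_mx G : 'M[C]_n := \matrix_(i, j) expect (fun u => G u i j).

Lemma expect_mxE G i j : expect_mx G i j = expect (fun u => G u i j).
Proof. exact: mxE. Qed.

Lemma tame_mx_cst (A : 'M[C]_n) : tame_mx (fun=> A).
Proof. by move=> i j; exact: tame_cst. Qed.

Lemma tame_mxM G H : tame_mx G -> tame_mx H -> tame_mx (fun u => G u *m H u).
Proof.
move=> tG tH i j; under eq_fun => u do rewrite mxE.
by apply: tame_sum => k; exact: tameM.
Qed.

Lemma tame_mx_id : tame_mx id.
Proof. by move=> i j; exact: (tame_coord hU). Qed.

Lemma tame_mx_tr G : tame_mx G -> tame_mx (fun u => (G u)^T).
Proof. by move=> tG i j; under eq_fun => u do rewrite mxE. Qed.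

Lemma tame_mx_adj G : tame_mx G -> tame_mx (fun u => adjmx (G u)).
Proof. by move=> tG i j; under eq_fun => u do rewrite adjmxE; exact: tame_conj. Qed.

Lemma tame_mx_linear T G : tame_mx G -> tame_mx (fun u => T (G u)).
Proof.
move=> tG i j; under eq_fun => u do rewrite linear_mxE.
apply: tame_sum => k; apply: tame_sum => l.
by apply: tameM => //; exact: tame_cst.
Qed.

(** The entries are polynomials in the entries of [u] and their conjugates. *)
Lemma tame_rho T x : tame_mx (fun u => rho u T x).
Proof.
apply: tame_mxM; last exact: (tame_mx_adj _ tame_mx_id).
apply: tame_mxM; first exact: tame_mx_id.
apply: tame_mx_linear; apply: tame_mxM; last first.
  exact: (tame_mx_adj _ (tame_mx_tr _ tame_mx_id)).
by apply: tame_mxM; [exact: (tame_mx_tr _ tame_mx_id) | exact: tame_mx_cst].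
Qed.

Lemma twirlE (T : 'M[C]_n -> 'M[C]_n) x :
  twirl P U T x = expect_mx (fun u => rho u T x).
Proof. by []. Qed.

Lemma eq_expect (g h : 'M[C]_n -> C) :
  (forall u, unitary u -> g u = h u) -> expect g = expect h.
Proof.
have [uU _ _] := hU => gh.
by congr Complex; apply: eq_Rintegral => w _; rewrite gh.
Qed.

Lemma expect_mxM A B G : tame_mx G ->
  expect_mx (fun u => A *m G u *m B) = A *m expect_mx G *m B.
Proof.
move=> tG; apply/matrixP => i j; rewrite !mxE.
transitivity (expect (fun u => \sum_k \sum_l (A i l * B k j) * G u l k)).
  congr expect; apply/funext => u; rewrite mxE; apply: eq_bigr => k _.
  by rewrite mxE mulr_suml; apply: eq_bigr => l _; ring.
rewrite expect_sum => [|k]; last first.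
  by apply: tame_sum => l; apply: tameM => //; exact: tame_cst.
apply: eq_bigr => k _; rewrite mxE mulr_suml expect_sum => [|l]; last first.
  by apply: tameM => //; exact: tame_cst.
by apply: eq_bigr => l _; rewrite expectZ // mxE; ring.
Qed.

Lemma twirl_linear T : linear (twirl P U T).
Proof.
move=> c x y; rewrite (twirlE _ (c *: x + y)) (twirlE _ x) (twirlE _ y).
apply/matrixP => i j; rewrite [RHS]mxE.
rewrite [X in _ = X + _]mxE.
rewrite [LHS]expect_mxE.
rewrite [X in _ = _ + X]expect_mxE.
rewrite [X in _ = _ * X + _]expect_mxE.
have t1 : tame (fun u => rho u T x i j) by exact: tame_rho.
have t2 : tame (fun u => rho u T y i j) by exact: tame_rho.
rewrite -(expectZ c _ t1).
rewrite -(expectD _ _ (tameM _ _ (tame_cst c) t1) t2).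
congr expect; apply/funext => u.
by rewrite /rho mulmxDr mulmxDl -scalemxAr -scalemxAl linearP /=
  mulmxDr mulmxDl -scalemxAr -scalemxAl !mxE.
Qed.

(** Multiplication by fixed matrices passes through the expectation, and [rho v] after [rho u] is
    [rho (v u)]; left invariance then removes [v]. *)
Lemma rho_twirl T v x : unitary v -> rho v (twirl P U T) x = twirl P U T x.
Proof.
move=> uv; rewrite {1}/rho (twirlE _ (_ *m _)) (twirlE _ x) -expect_mxM; last exact: tame_rho.
transitivity (expect_mx (fun u => rho (v *m u) T x)).
  by congr expect_mx; apply/funext => u; rewrite rhoM.
apply/matrixP => i j; rewrite [LHS]expect_mxE [RHS]expect_mxE.
exact: (expect_invl hU v (fun u => rho u T x i j) uv (tame_rho T x i j)).
Qed.

(** A finite sum of entries commutes with the expectation, and the resulting integrand is constant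
    on unitaries. *)
Lemma tr1_twirl T : tr1 (twirl P U T) = tr1 T.
Proof.
transitivity (expect (fun u => tr1 (rho u T))).
  rewrite expect_sum => [|i]; last exact: tame_rho.
  by apply: eq_bigr => i _; rewrite -expect_mxE.
by rewrite -[RHS](@expect_cst _ _ _ _ P U); apply: eq_expect => u; exact: tr1_rho.
Qed.

Lemma trflip_twirl T : trflip (twirl P U T) = trflip T.
Proof.
transitivity (expect (fun u => trflip (rho u T))); last first.
  rewrite -[RHS](@expect_cst _ _ _ _ P U).
  by apply: eq_expect => u; exact: trflip_rho.
rewrite expect_sum => [|i]; last by apply: tame_sum => j; exact: tame_rho.
apply: eq_bigr => i _; rewrite expect_sum => [|j]; last exact: tame_rho.
by apply: eq_bigr => j _; rewrite -expect_mxE.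
Qed.

Lemma twirl_invariant (T : 'M[C]_n -> 'M[C]_n) x :
  (forall u, unitary u -> rho u T x = T x) -> twirl P U T x = T x.
Proof.
move=> rT; apply/matrixP => i j; rewrite (twirlE T) expect_mxE.
by rewrite -[RHS](@expect_cst _ _ _ _ P U); apply: eq_expect => u /rT ->.
Qed.

Lemma twirl_tr T x : (2 <= n)%N ->
  twirl P U T x =
    ((2 * n%:R)^-1 * (tr1 T + trflip T)) *: Wplus x +
    ((2 * n%:R)^-1 * (tr1 T - trflip T)) *: Wminus x.
Proof.
move=> n2; pose S y := twirl P U T y^T.
have linS : linear S by move=> c y z; rewrite /S linearP twirl_linear.
pose S' : {linear 'M[C]_n -> 'M[C]_n} := HB.pack S
  (GRing.isLinear.Build _ _ _ _ S linS).
have [|al [be SE]] := unitary_covariantP S' _ n2.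
  move=> v uv y; rewrite -[RHS]/(v *m twirl P U T y^T *m adjmx v).
  rewrite -[LHS]/(twirl P U T (v *m y *m adjmx v)^T).
  (* The transpose in [S] is arranged so that [rho v], evaluated at this argument, cancels [v]
     inside and leaves [y^T]. *)
  have yE : v^T *m (v *m y *m adjmx v)^T *m adjmx v^T = y^T.
    rewrite adjmx_tr -!trmx_mul !mulmxA unitaryC // mul1mx.
    by rewrite -mulmxA unitaryC // mulmx1.
  by rewrite -(rho_twirl T v (v *m y *m adjmx v)^T uv) /rho yE.
have twE y : twirl P U T y = (al * \tr y)%:M + be *: y^T.
  have := SE y^T; rewrite mxtrace_tr => <-.
  by rewrite -[RHS]/(twirl P U T (y^T)^T) trmxK.
have e1 := tr1_twirl T; have e2 := trflip_twirl T.
have n0 : (n%:R : C) != 0 by rewrite pnatr_eq0 -lt0n ltnW.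
(* The two invariants of [al tr(y) 1 + be y^T] form a linear system for [al] and [be]. *)
have {}e1 : tr1 T = al * n%:R ^+ 2 + be * n%:R.
  rewrite -e1 /tr1 twE mxtraceD mxtraceZ trmx1 mxtrace1 mxtrace_scalar.
  by rewrite -[X in X + _]mulr_natr; ring.
have {}e2 : trflip T = al * n%:R + be * n%:R ^+ 2.
  rewrite -e2 /trflip.
  transitivity (\sum_(i < n) (al + be * n%:R)).
    apply: eq_bigr => i _.
    transitivity (\sum_(j < n) (al * (i == j)%:R + be)).
      apply: eq_bigr => j _; rewrite twE -[X in \tr X]mul1mx mxtrace_mul_delta.
      by rewrite !mxE !eqxx [j == i]eq_sym mulr1; case: (i == j);
        rewrite ?mulr0 ?mul0rn.
    rewrite big_split /= sumr_const card_ord mulr_natr; congr (_ + _).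
    rewrite (bigD1 i) //= eqxx mulr1 big1 ?addr0 // => j ji.
    by rewrite eq_sym (negPf ji) mulr0.
  by rewrite sumr_const card_ord -[LHS]mulr_natr; ring.
have nSE : (n.+1%:R : C) = n%:R + 1 by rewrite -natr1.
have nS : (n%:R + 1 : C) != 0 by rewrite -nSE pnatr_eq0.
have nP : (n.-1%:R : C) = n%:R - 1 by rewrite -[in RHS](prednK (ltnW n2)) -addn1 natrD addrK.
have nP0 : (n%:R - 1 : C) != 0 by rewrite -nP pnatr_eq0 -lt0n -ltnS prednK // ltnW.
(* The coefficients become [(n + 1)(al + be) / 2] and [(n - 1)(al - be) / 2]; the prefactors of the
   channels cancel [n + 1] and [n - 1]. *)
rewrite twE e1 e2 /Wplus /Wminus nP nSE.
rewrite -scalemx1; move: (1%:M : 'M[C]_n) x^T (\tr x) => I1 X t.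
apply/matrixP => i j; rewrite !mxE; move: (I1 i j) (X i j) => p q.
move: (n%:R : C) n0 nS nP0 => N n0 nS nP0.
by field; rewrite n0 nS nP0.
Qed.

End Twirl.

(** * Invariance of the Holevo-Werner channels and the Jamiolkowski coefficients *)

Section Rho.
Context {R : realType} {n : nat}.
Local Notation C := R[i].
Implicit Types u x : 'M[C]_n.

(** With [y = u^t x u^{t*}], the trace is unchanged and [y^t = u^* x^t u], which the outer
    conjugation by [u] turns back into [x^t]. Both channels are instances, with [e = 1] and
    [e = -1]. *)
Lemma rho_trace_transpose u x (c e : C) : unitary u ->
  rho u (fun y => c *: (\tr y *: 1%:M + e *: y^T)) x =
  c *: (\tr x *: 1%:M + e *: x^T).
Proof.
move=> uu; rewrite /rho; set y := u^T *m x *m adjmx u^T.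
have -> : \tr y = \tr x.
  by rewrite /y mxtrace_mulC mulmxA adjmx_tr -trmx_mul uu trmx1 mul1mx.
have -> : y^T = adjmx u *m x^T *m u.
  by rewrite /y !trmx_mul adjmx_tr !trmxK mulmxA.
rewrite -scalemxAr -scalemxAl mulmxDr mulmxDl -!scalemxAr -!scalemxAl mulmx1 uu.
by rewrite !mulmxA uu mul1mx -mulmxA uu mulmx1.
Qed.

Lemma rho_Wplus u x : unitary u -> rho u (@Wplus R n) x = Wplus x.
Proof.
move=> /(rho_trace_transpose u x (n.+1%:R)^-1 1); rewrite scale1r -/(Wplus x) => <-.
by congr (rho _ _ x); apply/funext => y; rewrite scale1r.
Qed.

Lemma rho_Wminus u x : unitary u -> rho u (@Wminus R n) x = Wminus x.
Proof.
move=> /(rho_trace_transpose u x (n.-1%:R)^-1 (-1)); rewrite scaleN1r -/(Wminus x) => <-.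
by congr (rho _ _ x); apply/funext => y; rewrite scaleN1r.
Qed.

Lemma mxtrace_jamiolkowski_pplus (T : {linear 'M[C]_n -> 'M[C]_n}) :
  \tr (jamiolkowski T *m pplus R n) = (2 * n%:R)^-1 * (tr1 T + trflip T).
Proof.
rewrite /pplus -scalemxAr mxtraceZ mulmxDr mulmx1 mxtraceD.
by rewrite mxtrace_jamiolkowski mxtrace_jamiolkowski_flip -mulrDr mulrA -invfM.
Qed.

Lemma mxtrace_jamiolkowski_pminus (T : {linear 'M[C]_n -> 'M[C]_n}) :
  \tr (jamiolkowski T *m pminus R n) = (2 * n%:R)^-1 * (tr1 T - trflip T).
Proof.
rewrite /pminus -scalemxAr mxtraceZ mulmxBr mulmx1 mxtraceD raddfN /=.
by rewrite mxtrace_jamiolkowski mxtrace_jamiolkowski_flip -mulrBr mulrA -invfM.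
Qed.

Lemma kraus_linear (k : nat) (a : 'I_k -> 'M[C]_n) :
  linear (fun x => \sum_(m < k) a m *m x *m adjmx (a m)).
Proof.
move=> c x y; rewrite scaler_sumr -big_split /=; apply: eq_bigr => m _.
by rewrite mulmxDr mulmxDl -scalemxAr -scalemxAl.
Qed.

End Rho.

(** * The three statements on the twirling map *)

Theorem theorem4p5 (R : realType) (n : nat) (hn : (2 <= n)%N)
  (d : measure_display) (Omega : measurableType d) (P : probability Omega R)
  (U : Omega -> 'M[R[i]]_n) (hU : haar_unitary P U) :
  [/\ (forall x, twirl P U (@Wplus R n) x = Wplus x)
        /\ (forall x, twirl P U (@Wminus R n) x = Wminus x),
      (forall T : {linear 'M[R[i]]_n -> 'M[R[i]]_n}, forall x,
        twirl P U T x =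
          \tr (jamiolkowski T *m pplus R n) *: Wplus x
          + \tr (jamiolkowski T *m pminus R n) *: Wminus x) &
      (forall (T : 'M[R[i]]_n -> 'M[R[i]]_n) (k : nat) (a : 'I_k -> 'M[R[i]]_n),
        (forall x, T x = \sum_(i < k) a i *m x *m adjmx (a i)) ->
        forall x,
        twirl P U T x =
          (4^-1 * \sum_(i < k) norm2sq (a i + (a i)^T)) *: Wplus x
          + (4^-1 * \sum_(i < k) norm2sq (a i - (a i)^T)) *: Wminus x)].
Proof.
split.
- by split=> x; apply: (twirl_invariant hU) => u uu;
    [exact: rho_Wplus | exact: rho_Wminus].
- move=> T x; rewrite (twirl_tr hU) // mxtrace_jamiolkowski_pplus.
  by rewrite mxtrace_jamiolkowski_pminus.
- move=> T k a /funext -> x.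
  (* The Kraus formula is packed as a linear map so that [twirl_tr] applies to it. *)
  pose K : {linear 'M[R[i]]_n -> 'M[R[i]]_n} := HB.pack
    (fun x => \sum_(m < k) a m *m x *m adjmx (a m))
    (GRing.isLinear.Build _ _ _ _ _ (kraus_linear k a)).
  rewrite -[LHS]/(twirl P U K x) (twirl_tr hU K x hn).
  rewrite (tr1_kraus k a) (trflip_kraus k a) -big_split -sumrB /= !mulr_sumr.
  congr (_ *: _ + _ *: _); apply: eq_bigr => m _.
    have := norm2sqDZ (a m) 1 (conjc1 R) (mulr1 1).
    by rewrite scale1r mul1r => ->.
  have := norm2sqDZ (a m) (-1) (rmorphN1 conjc) (etrans (mulrNN 1 1) (mulr1 1)).
  by rewrite scaleN1r mulN1r => ->.
Qed.
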